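(* Let $k$ be an algebraically closed field of characteristic $0$ and let $R$ be a commutative complete Gorenstein local $k$-algebra. Let $0\to Z\to Y\xrightarrow{f}X\to0$ be an AR sequence in $\mathrm{CM}(R)$ ending in $X$. Then the induced triangle $\underline{Z}\to\underline{Y}\xrightarrow{\underline{f}}\underline{X}\xrightarrow{\underline{w}}\underline{Z}[1]$ in $\underline{\mathrm{CM}}(R)$ is an AR triangle ending in $\underline{X}$.
   Context: Local rings are Noetherian. A finitely generated $R$-module $M$ is called Cohen-Macaulay if $\mathrm{Ext}^i_R(M,R)=0$ for all $i>0$; $\mathrm{CM}(R)$ is the category of these modules with all $R$-homomorphisms. The stable category $\underline{\mathrm{CM}}(R)$ has the same objects and morphisms $\underline{\mathrm{Hom}}_R(M,N)=\mathrm{Hom}_R(M,N)/P(M,N)$, where $P(M,N)$ is the set of homomorphisms factoring through a free $R$-module. $\underline{M}$, $\underline{f}$ denote an object $M$ and (the class of) a morphism $f$ viewed in $\underline{\mathrm{CM}}(R)$. The syzygy functor $\Omega$ is an auto-equivalence of $\underline{\mathrm{CM}}(R)$, and $\underline{\mathrm{CM}}(R)$ is triangulated with shift $[1]$ inverse to $\Omega$; every short exact sequence $0\to L\to M\to N\to0$ in $\mathrm{CM}(R)$ induces a triangle $\underline{L}\to\underline{M}\to\underline{N}\to\underline{L}[1]$, and all triangles arise in this way up to isomorphism. AR sequence: a short exact sequence $0\to Z\to Y\xrightarrow{f}X\to0$ in $\mathrm{CM}(R)$ is an AR sequence ending in $X$ if (AR1) $X$ and $Z$ are indecomposable; (AR2)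 it is not split; (AR3) for every $g:W\to X$ in $\mathrm{CM}(R)$ which is not a split epimorphism there is $h:W\to Y$ with $g=f\circ h$. AR triangle: a triangle $\underline{Z}\to\underline{Y}\xrightarrow{\underline f}\underline{X}\xrightarrow{\underline w}\underline{Z}[1]$ is an AR triangle ending in $\underline{X}$ if (ART1) $\underline{X}$ and $\underline{Z}$ are indecomposable; (ART2) $\underline{w}\neq0$; (ART3) for every $\underline{g}:\underline{W}\to\underline{X}$ which is not a split epimorphism there is $\underline{h}:\underline{W}\to\underline{Y}$ with $\underline{g}=\underline{f}\circ\underline{h}$. *)

(* Defs.v *)
From HB Require Import structures.
From mathcomp Require Import all_boot all_order all_algebra.
From mathcomp Require Import boolp classical_sets functions cardinality fsbigop.

Set Implicit Arguments.
Unset Strict Implicit.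
Unset Printing Implicit Defensive.
Import GRing.Theory.
Local Open Scope classical_set_scope.
Local Open Scope ring_scope.

Section Rings.
Variable R : comNzRingType.

Definition is_ideal (I : set R) : Prop :=
  [/\ I 0, forall x y, I x -> I y -> I (x + y) & forall r x, I x -> I (r * x)].

Definition noetherian_ring : Prop :=
  forall I : set R, is_ideal I ->
    exists n (g : 'I_n -> R),
      I = [set x | exists c : 'I_n -> R, x = \sum_i c i * g i].

Definition maximal_ideal (m : set R) : Prop :=
  [/\ is_ideal m, ~ m 1 &
      forall I : set R, is_ideal I -> ~ I 1 -> m `<=` I -> I = m].

Definition local_ring (m : set R) : Prop :=
  maximal_ideal m /\ forall n, maximal_ideal n -> n = m.

Definition ideal_mul (I J : set R) : set R :=
  [set x | exists n (a b : 'I_n -> R),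
      (forall i, I (a i) /\ J (b i)) /\ x = \sum_i a i * b i].

Fixpoint ideal_exp (I : set R) (n : nat) : set R :=
  if n is p.+1 then ideal_mul (ideal_exp I p) I else setT.

(* The canonical map from R to the inverse limit of the R / m^n is injective
   and surjective. *)
Definition adically_complete (m : set R) : Prop :=
  (forall x, (forall n, ideal_exp m n x) -> x = 0) /\
  (forall x : nat -> R, (forall n, ideal_exp m n (x n.+1 - x n)) ->
     exists y, forall n, ideal_exp m n (y - x n)).

End Rings.

Section Modules.
Variable R : comNzRingType.
Implicit Types L M N F : lmodType R.

Definition finitely_generated M : Prop :=
  exists n (g : 'I_n -> M), forall x, exists c : 'I_n -> R, x = \sum_i c i *: g i.

(* F has a basis (e i)_(i : I), possibly infinite. *)
Definition free_module F : Prop :=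
  exists (I : choiceType) (e : I -> F), forall x, exists! c : I -> R,
    finite_set [set i | c i != 0] /\ x = \sum_(i \in [set: I]) c i *: e i.

Definition projective_module (P : lmodType R) : Prop :=
  forall M N (u : {linear M -> N}) (g : {linear P -> N}),
    (forall y, exists x, u x = y) ->
    exists h : {linear P -> M}, forall x, u (h x) = g x.

Definition injective_module (J : lmodType R) : Prop :=
  forall M N (u : {linear M -> N}) (g : {linear M -> J}),
    injective u -> exists h : {linear N -> J}, forall x, h (u x) = g x.

Definition exact_at L M N (u : L -> M) (v : M -> N) : Prop :=
  forall y, v y = 0 <-> exists x, u x = y.

Definition short_exact L M N (u : L -> M) (v : M -> N) : Prop :=
  [/\ injective u, exact_at u v & forall z, exists y, v y = z].

Record projective_resolution M := ProjectiveResolution {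
  pres : nat -> lmodType R;
  pres_d : forall i, {linear pres i.+1 -> pres i};
  pres_aug : {linear pres 0%N -> M};
  pres_proj : forall i, projective_module (pres i);
  pres_surj : forall x, exists y, pres_aug y = x;
  pres_exact0 : exact_at (pres_d 0%N) pres_aug;
  pres_exact : forall i, exact_at (pres_d i.+1) (pres_d i)
}.

Definition coboundary M (P : projective_resolution M) N i :
    {linear pres P i -> N} -> Prop :=
  match i with
  | 0 => fun g => forall x, g x = 0
  | j.+1 => fun g =>
      exists h : {linear pres P j -> N}, forall x, g x = h (pres_d P j x)
  end.

(* Ext^i(M, N) = 0: the complex Hom(P, N) has zero cohomology in degree i. *)
Definition Ext_vanishes i M N : Prop :=
  forall (P : projective_resolution M) (g : {linear pres P i -> N}),
    (forall x, g (pres_d P i x) = 0) -> coboundary g.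

Definition finite_injective_dimension M : Prop :=
  exists (J : nat -> lmodType R) (eps : {linear M -> J 0%N})
         (d : forall i, {linear J i -> J i.+1}) (n : nat),
    [/\ forall i, injective_module (J i),
        injective eps, exact_at eps (d 0%N),
        forall i, exact_at (d i) (d i.+1) &
        forall i, (n < i)%N -> forall x : J i, x = 0].

End Modules.

(* For a Noetherian local ring. *)
Definition gorenstein (R : comNzRingType) : Prop :=
  @finite_injective_dimension R R^o.

Record CM (R : comNzRingType) := MkCM {
  CM_module :> lmodType R;
  CM_fg : finitely_generated CM_module;
  CM_ext : forall i, (0 < i)%N -> Ext_vanishes i CM_module R^o
}.

(* Morphisms of the stable category are represented by linear maps, compared
   up to [stable_eq]; those of CM(R) are compared up to [hom_eq].  The notions
   that make sense in both categories take the comparison as a parameter. *)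
Definition hom_rel (R : comNzRingType) :=
  forall M N : lmodType R, (M -> N) -> (M -> N) -> Prop.

Definition hom_eq {R : comNzRingType} : hom_rel R := fun M N f g => f =1 g.

Definition stable_eq {R : comNzRingType} : hom_rel R := fun M N f g =>
  exists F : lmodType R, free_module F /\
  exists (u : {linear M -> F}) (v : {linear F -> N}),
    forall x, f x - g x = v (u x).

Section Category.
Variables (R : comNzRingType) (eqv : hom_rel R).
Arguments eqv {M N}.

Definition split_epi (W X : CM R) (g : {linear W -> X}) : Prop :=
  exists s : {linear X -> W}, eqv (g \o s) idfun.

Definition iso (X Y : CM R) (g : {linear X -> Y}) : Prop :=
  exists h : {linear Y -> X}, eqv (h \o g) idfun /\ eqv (g \o h) idfun.

Definition zero_object (X : CM R) : Prop :=
  eqv (idfun : X -> X) (fun=> 0).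

Definition biproduct (X A B : CM R) : Prop :=
  exists (i : {linear A -> X}) (j : {linear B -> X})
         (p : {linear X -> A}) (q : {linear X -> B}),
    [/\ eqv (p \o i) idfun, eqv (q \o j) idfun,
        eqv (q \o i) (fun=> 0), eqv (p \o j) (fun=> 0) &
        eqv (fun x => i (p x) + j (q x)) idfun].

Definition indecomposable (X : CM R) : Prop :=
  ~ zero_object X /\
  forall A B : CM R, biproduct X A B -> zero_object A \/ zero_object B.

End Category.

Arguments split_epi {R} eqv {W X} g.
Arguments iso {R} eqv {X Y} g.

Section AuslanderReiten.
Variable R : comNzRingType.
Implicit Types W X Y Z : CM R.

Definition AR_sequence Z Y X (a : {linear Z -> Y}) (f : {linear Y -> X}) : Prop :=
  [/\ short_exact a f,
      indecomposable hom_eq X /\ indecomposable hom_eq Z,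
      ~ split_epi hom_eq f &
      forall W (g : {linear W -> X}), ~ split_epi hom_eq g ->
        exists h : {linear W -> Y}, hom_eq g (f \o h)].

(* An exact sequence 0 -> Z -> F -> Z[1] -> 0 in CM(R) with F free, so that Z
   is a syzygy of Z[1]. *)
Record cosyzygy Z := Cosyzygy {
  cos_free : CM R;
  cos_obj : CM R;
  cos_in : {linear Z -> cos_free};
  cos_out : {linear cos_free -> cos_obj};
  cos_freeP : free_module cos_free;
  cos_exact : short_exact cos_in cos_out
}.

(* A choice of Z[1] for every Z. Two choices give canonically isomorphic shift
   functors on the stable category. *)
Definition shift := forall Z, cosyzygy Z.

Variable T : shift.
Local Notation "Z [1]" := (cos_obj (T Z)) (at level 2, format "Z [1]").

(* z1 represents the class of z[1]. *)
Definition shift_hom Z Z' (z : {linear Z -> Z'}) (z1 : {linear Z[1] -> Z'[1]}) :=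
  exists e : {linear cos_free (T Z) -> cos_free (T Z')},
    (forall x, e (cos_in (T Z) x) = cos_in (T Z') (z x)) /\
    (forall x, z1 (cos_out (T Z) x) = cos_out (T Z') (e x)).

(* The third map of the triangle induced by the exact sequence (a, f):
     0 -> Z -> Y -> X    -> 0
          ||   |e   |w
     0 -> Z -> F -> Z[1] -> 0
   With the opposite sign convention w becomes - w; the AR conditions do not
   depend on this. *)
Definition connecting Z Y X (a : {linear Z -> Y}) (f : {linear Y -> X})
    (w : {linear X -> Z[1]}) : Prop :=
  exists e : {linear Y -> cos_free (T Z)},
    (forall x, e (a x) = cos_in (T Z) x) /\
    (forall y, w (f y) = cos_out (T Z) (e y)).

Definition induced_triangle Z Y X (a : {linear Z -> Y}) (f : {linear Y -> X})
    (w : {linear X -> Z[1]}) : Prop :=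
  short_exact a f /\ connecting a f w.

Definition triangle Z Y X (a : {linear Z -> Y}) (f : {linear Y -> X})
    (w : {linear X -> Z[1]}) : Prop :=
  exists Z' Y' X' (a' : {linear Z' -> Y'}) (f' : {linear Y' -> X'})
         (w' : {linear X' -> Z'[1]}),
    induced_triangle a' f' w' /\
  exists (z : {linear Z -> Z'}) (y : {linear Y -> Y'}) (x : {linear X -> X'})
         (z1 : {linear Z[1] -> Z'[1]}),
    [/\ [/\ iso stable_eq z, iso stable_eq y & iso stable_eq x],
        shift_hom z z1,
        stable_eq (y \o a) (a' \o z),
        stable_eq (x \o f) (f' \o y) &
        stable_eq (z1 \o w) (w' \o x)].

Definition AR_triangle Z Y X (a : {linear Z -> Y}) (f : {linear Y -> X})
    (w : {linear X -> Z[1]}) : Prop :=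
  [/\ triangle a f w,
      indecomposable stable_eq X /\ indecomposable stable_eq Z,
      ~ stable_eq w (fun=> 0) &
      forall W (g : {linear W -> X}), ~ split_epi stable_eq g ->
        exists h : {linear W -> Y}, stable_eq g (f \o h)].

End AuslanderReiten.

(* Main.v *)
(* The stable statement comes down to two facts about R.

   Duality: as R has finite injective dimension, Ext^i(K, R) = 0 for i > 0 as
   soon as K is an n-th syzygy for every n.  The dual of a Cohen-Macaulay module
   is such a module, by dualizing a free resolution; it follows that
   Cohen-Macaulay modules are reflexive and embed into finite free modules with
   Cohen-Macaulay cokernel.  This gives the shift, and it lets every map from Z
   to a finite free module extend to Y; if w, X or Z vanishes stably, such an
   extension or a lift splits the AR sequence.

   Completeness: if X is indecomposable and e an endomorphism of X, then e or
   1 - e is invertible, by lifting to R[t]/(d), with d(e) = 0, the idempotent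
   that separates the factors t^a and q of d modulo m.  For e the idempotent of a
   stable decomposition of X, this kills one of the two stable summands. *)
Require Import Defs.
From HB Require Import structures.
From mathcomp Require Import all_boot all_order all_algebra.
From mathcomp Require Import finmap ring.
From mathcomp Require Import boolp classical_sets functions cardinality fsbigop.

Set Implicit Arguments.
Unset Strict Implicit.
Unset Printing Implicit Defensive.
Import GRing.Theory.
Local Open Scope classical_set_scope.
Local Open Scope ring_scope.

(** * Linear maps and submodules *)

Section LinearMaps.
Variable R : comNzRingType.
Implicit Types L M N A B : lmodType R.

Lemma linear_ex M N (f : M -> N) :
  linear f -> exists h : {linear M -> N}, h =1 f.
Proof.
move=> lf; pose fL := GRing.isLinear.Build R M N *:%R f lf.
by pose F : {linear M -> N} := HB.pack f fL; exists F.
Qed.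

Lemma factor_surj A M N (v : {linear A -> M}) (g : {linear A -> N}) :
    (forall y, exists x, v x = y) -> (forall x, v x = 0 -> g x = 0) ->
  exists h : {linear M -> N}, forall x, h (v x) = g x.
Proof.
move=> vs vg; have [s sP] := choice vs.
have Hs x : g (s (v x)) = g x.
  by apply/eqP; rewrite -subr_eq0 -linearB vg // linearB /= sP subrr.
have [|h hE] := @linear_ex M N (fun y => g (s y)); last first.
  by exists h => x; rewrite hE Hs.
move=> a x y /=; rewrite -linearP -{1}(sP x) -{1}(sP y) -linearP.
exact: Hs.
Qed.

Lemma factor_inj A M N (u : {linear M -> N}) (g : {linear A -> N}) :
    injective u -> (forall x, exists y, u y = g x) ->
  exists h : {linear A -> M}, forall x, u (h x) = g x.
Proof.
move=> ui ug; have [s sP] := choice ug.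
have [|h hE] := @linear_ex A M s; last by exists h => x; rewrite hE.
by move=> a x y; apply: ui; rewrite linearP !sP linearP.
Qed.

Section Submodule.
Variables (M : lmodType R) (S : set M).
Hypotheses (S0 : S 0) (SP : forall a x y, S x -> S y -> S (a *: x + y)).

Let pS : pred M := fun x => `[< S x >].

Let pSP : subsemimod_closed pS.
Proof.
split; first split.
- exact/asboolP.
- move=> x y /asboolP Sx /asboolP Sy; apply/asboolP.
  by rewrite -[x]scale1r; apply: SP.
- move=> a x /asboolP Sx; apply/asboolP.
  by rewrite -[_ *: _]addr0; apply: SP.
Qed.


Lemma submod_ex : exists (N : lmodType R) (i : {linear N -> M}),
  injective i /\ forall x, S x <-> exists y, i y = x.
Proof.
pose C := GRing.SubChoice_isSubLmodule.Build R M pS {x : M | pS x} pSP.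
pose N : GRing.SubLmodule.type pS := HB.pack {x : M | pS x} C.
exists N.
have [|i iE] := @linear_ex N M val; first exact: linearP.
exists i; split=> [x y|x]; first by rewrite !iE => /val_inj.
split=> [Sx|[y <-]]; last by rewrite iE; apply/asboolP; exact: (valP y).
have pSx : pS x by apply/asboolP.
by exists (Sub x pSx : N); rewrite iE SubK.
Qed.
End Submodule.

Lemma kernel_ex M N (v : {linear M -> N}) :
  exists (K : lmodType R) (i : {linear K -> M}), injective i /\ exact_at i v.
Proof.
have [||K [i [ii iP]]] := @submod_ex M [set x | v x = 0].
- by rewrite /= linear0.
- by move=> a x y /= vx vy; rewrite linearP vx vy scaler0 addr0.
by exists K, i; split=> // y; exact: iP.
Qed.

(** [K] is the image of [u], identified with the kernel of [v]. Injective modules extend maps only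
    along injections, so [g] is first pushed down to this image. *)
Lemma factor_exact A M N L (u : {linear A -> M}) (v : {linear M -> N})
    (g : {linear A -> L}) :
    exact_at u v -> (forall x, u x = 0 -> g x = 0) ->
  exists (K : lmodType R) (i : {linear K -> M}) (h : {linear K -> L})
         (p : {linear A -> K}),
    [/\ injective i, exact_at i v, forall x, i (p x) = u x,
      forall x, h (p x) = g x & forall y, exists x, p x = y].
Proof.
move=> uv ug; have [K [i [ii iv]]] := kernel_ex v.
have [|p pE] := @factor_inj A K M i u ii.
  by move=> x; apply/iv/uv; exists x.
have ps y : exists x, p x = y.
  have /uv [x ux] : v (i y) = 0 by apply/iv; exists y.
  by exists x; apply: ii; rewrite pE.
have [|h hE] := @factor_surj A K L p g ps.
  by move=> x px0; apply: ug; rewrite -pE px0 linear0.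
by exists K, i, h, p.
Qed.

End LinearMaps.

(** * Free and Noetherian modules *)

Section FreeModules.
Variable R : comNzRingType.
Implicit Types M N P F : lmodType R.

Lemma linear_rVE M n (v : {linear 'rV[R]_n -> M}) c :
  v c = \sum_i c 0 i *: v (delta_mx 0 i).
Proof.
by rewrite {1}[c]row_sum_delta linear_sum; apply: eq_bigr => i _; rewrite linearZ.
Qed.

Lemma linear_rV_ex M n (g : 'I_n -> M) :
  exists v : {linear 'rV[R]_n -> M}, forall i, v (delta_mx 0 i) = g i.
Proof.
have [|v vE] := @linear_ex R 'rV[R]_n M (fun c => \sum_i c 0 i *: g i).
  move=> a x y; rewrite scaler_sumr -big_split; apply: eq_bigr => i _ /=.
  by rewrite !mxE scalerDl scalerA.
exists v => i; rewrite vE (bigD1 i) //= mxE !eqxx scale1r big1 ?addr0 // => j ji.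
by rewrite mxE (negPf ji) andbF scale0r.
Qed.

Lemma eq_linear_rV M n (u v : {linear 'rV[R]_n -> M}) :
  (forall i, u (delta_mx 0 i) = v (delta_mx 0 i)) -> u =1 v.
Proof.
by move=> uv c; rewrite linear_rVE [RHS]linear_rVE; apply: eq_bigr => i _; rewrite uv.
Qed.

Lemma projective_rV n : projective_module 'rV[R]_n.
Proof.
move=> M N u g us; have [s sP] := choice us.
have [h hE] := linear_rV_ex (fun i => s (g (delta_mx 0 i))).
exists h; apply: (@eq_linear_rV _ _ (u \o h : {linear _ -> _}) g) => i /=.
by rewrite hE sP.
Qed.

Lemma free_rV n : free_module 'rV[R]_n.
Proof.
have sumE (F : 'I_n -> 'rV[R]_n) : \sum_(i \in [set: 'I_n]) F i = \sum_i F i.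
  rewrite (fsbigE (index_enum 'I_n)) ?index_enum_uniq //.
    by apply: eq_bigl => i; rewrite in_setT.
  by move=> i _; rewrite mem_index_enum.
exists 'I_n, (fun i => delta_mx 0 i) => x; exists (fun i => x 0 i); split.
  split; first exact: finite_finset.
  by rewrite sumE -row_sum_delta.
move=> c [_]; rewrite sumE => ->; apply/funext => i.
rewrite summxE (bigD1 i) //= !mxE !eqxx mulr1 big1 ?addr0 // => j ji.
by rewrite !mxE eq_sym (negPf ji) mulr0.
Qed.

Lemma free_projective F : free_module F -> projective_module F.
Proof.
move=> [I [e eP]] M N u g us.
have [m mP] := choice (fun i => us (g (e i))).
pose c x := projT1 (cid (eP x)).
have cP x : finite_set [set i | c x i != 0] /\
    x = \sum_(i \in [set: I]) c x i *: e i by exact: (projT2 (cid (eP x))).1.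
have c_uniq x d : finite_set [set i | d i != 0] /\
    x = \sum_(i \in [set: I]) d i *: e i -> c x = d.
  exact: (projT2 (cid (eP x))).2.
pose S x := fset_set [set i | c x i != 0].
have SP x i : i \notin S x -> c x i = 0.
  apply: contraNeq => ci; rewrite in_fset_set; last exact: (cP x).1.
  by rewrite inE.
have sumE (L : lmodType R) (f : I -> L) x (A : {fset I}) : {subset S x <= A} ->
    \sum_(i \in [set: I]) c x i *: f i = \sum_(i <- A) c x i *: f i.
  move=> SA; apply: fsbigTE => i iA; rewrite SP ?scale0r //.
  by apply: contra iA => /SA.
(* Linearity of coordinates comes from their uniqueness; all sums are taken over the finite union of
   the two supports. *)
have cD a x y : c (a *: x + y) = fun i => a * c x i + c y i.
  have fin : forall i, i \notin (S x `|` S y)%fset -> a * c x i + c y i = 0.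
    move=> i; rewrite inE negb_or => /andP[ix iy].
    by rewrite !SP // mulr0 addr0.
  apply: c_uniq; split.
    apply: (finite_subfset (S x `|` S y)%fset) => i /=; apply: contraNT => iS.
    by rewrite fin.
  rewrite {1}(cP x).2 {1}(cP y).2.
  rewrite !(@sumE _ e _ (S x `|` S y)%fset); first last.
  - by move=> i iS; rewrite inE iS.
  - by move=> i iS; rewrite inE iS orbT.
  rewrite (@fsbigTE _ _ _ _ (S x `|` S y)%fset); last first.
    by move=> i /fin ->; rewrite scale0r.
  rewrite scaler_sumr -big_split; apply: eq_bigr => i _ /=.
  by rewrite scalerDl scalerA.
have [|h hE] := @linear_ex R F M (fun x => \sum_(i \in [set: I]) c x i *: m i).
  move=> a x y; set A := (S x `|` (S y `|` S (a *: x + y)%R))%fset.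
  rewrite !(@sumE _ m _ A); try by move=> i iS; rewrite !inE iS ?orbT.
  rewrite cD scaler_sumr -big_split; apply: eq_bigr => i _ /=.
  by rewrite scalerDl scalerA.
exists h => x; rewrite hE (@sumE _ m _ (S x)) // [in RHS](cP x).2.
rewrite (@sumE _ e _ (S x)) // !linear_sum; apply: eq_bigr => i _.
by rewrite !linearZ /= mP.
Qed.

Lemma fg_rV M n (v : {linear 'rV[R]_n -> M}) :
  (forall y, exists x, v x = y) -> finitely_generated M.
Proof.
move=> vs; exists n, (fun i => v (delta_mx 0 i)) => y; have [x <-] := vs y.
by exists (fun i => x 0 i); rewrite -linear_rVE.
Qed.

(** Padding with the generator 0 at index 0 makes the rank a successor, so that square matrices of
    this size form a nonzero ring, as wanted for Cayley-Hamilton. *)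
Lemma fg_cover M : finitely_generated M ->
  exists n (v : {linear 'rV[R]_n.+1 -> M}), forall y, exists x, v x = y.
Proof.
move=> [n [g gP]]; exists n.
have [v vE] := linear_rV_ex (fun i : 'I_n.+1 => oapp g 0 (unlift ord0 i)).
exists v => y; have [c ->] := gP y.
exists (\row_i oapp c 0 (unlift ord0 i)).
rewrite linear_rVE big_ord_recl mxE unlift_none /= scale0r add0r.
by apply: eq_bigr => i _; rewrite mxE vE liftK.
Qed.

Lemma fg_surj M N (v : {linear M -> N}) : (forall y, exists x, v x = y) ->
  finitely_generated M -> finitely_generated N.
Proof.
move=> vs /fg_cover[n [w ws]]; apply: (@fg_rV _ _ (v \o w : {linear _ -> _})) => y.
by have [x <-] := vs y; have [c <-] := ws x; exists c.
Qed.

End FreeModules.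

Section Noetherian.
Variable R : comNzRingType.
Implicit Types M N K : lmodType R.

Definition noetherian_module M := forall K (i : {linear K -> M}),
  injective i -> finitely_generated K.

(** For [K] inside [M], let [S2] be its image in [M2] and [S1] its preimage in [M1]. Lifts of
    generators of [S2] and images of generators of [S1] together generate [K]. *)
Lemma noetherian_ext M1 M M2 (u : {linear M1 -> M}) (v : {linear M -> M2}) :
    exact_at u v -> noetherian_module M1 -> noetherian_module M2 ->
  noetherian_module M.
Proof.
move=> uv N1 N2 K i ii.
have [||S2 [i2 [ii2 i2P]]] := @submod_ex R M2 [set y | exists x, v (i x) = y].
- by exists 0; rewrite !linear0.
- by move=> a _ _ [x <-] [y <-]; exists (a *: x + y); rewrite !linearP.
have [|p pE] := @factor_inj R K S2 M2 i2 (v \o i : {linear _ -> _}) ii2.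
  by move=> x; apply/i2P; exists x.
have ps y : exists x, p x = y.
  have /i2P[x xE] : exists x, i2 x = i2 y by exists y.
  by exists x; apply: ii2; rewrite pE.
have [||S1 [i1 [ii1 i1P]]] := @submod_ex R M1 [set y | exists x, i x = u y].
- by exists 0; rewrite !linear0.
- by move=> a x y [x' xE] [y' yE]; exists (a *: x' + y'); rewrite !linearP xE yE.
have [|q qE] := @factor_inj R S1 K M i (u \o i1 : {linear _ -> _}) ii.
  by move=> x; apply/i1P; exists x.
have [n2 [w2 w2s]] := fg_cover (N2 _ _ ii2).
have [n1 [w1 w1s]] := fg_cover (N1 _ _ ii1).
have [l lE] := projective_rV w2 ps.
have [|g gE] := @linear_ex R 'rV[R]_(n1.+1 + n2.+1) K
   (fun c => q (w1 (lsubmx c)) + l (rsubmx c)).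
  by move=> a x y; rewrite !linearP scalerDr !addrA; congr (_ + _); rewrite addrAC.
apply: (fg_rV (v := g)) => x; have [c2 c2E] := w2s (p x).
have vx : v (i (x - l c2)) = 0.
  have := pE (x - l c2); rewrite linearB lE c2E subrr linear0 /= => <-//.
have /uv[y yE] := vx; have /i1P[s sE] : exists x, i x = u y by exists (x - l c2).
have [c1 c1E] := w1s s; exists (row_mx c1 c2).
rewrite gE row_mxKl row_mxKr c1E; have -> : q s = x - l c2; last by rewrite subrK.
by apply: ii; rewrite qE /= sE.
Qed.

Hypothesis R_noetherian : noetherian_ring R.

Lemma noetherian_regular : noetherian_module R^o.
Proof.
move=> K i ii; have [|n [g gE]] := R_noetherian (I := [set x | exists y, i y = x]).
  split; first by exists 0; rewrite linear0.
    by move=> _ _ [x <-] [y <-]; exists (x + y); rewrite linearD.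
  by move=> r _ [x <-]; exists (r *: x); rewrite linearZ.
have gi j : exists y, i y = g j.
  have : [set x | exists c : 'I_n -> R, x = \sum_i c i * g i] (g j).
    exists (fun k => (k == j)%:R); rewrite (bigD1 j) //= eqxx mul1r big1 ?addr0 //.
    by move=> k /negPf ->; rewrite mul0r.
  by rewrite -gE.
have [h hE] := choice gi; exists n, h => x.
have : [set y | exists x, i x = y] (i x) by exists x.
rewrite gE => -[c cE]; exists c; apply: ii; rewrite cE linear_sum.
by apply: eq_bigr => j _; rewrite linearZ hE.
Qed.

Lemma noetherian_rV n : noetherian_module 'rV[R]_n.
Proof.
elim: n => [|n IHn].
  move=> K i ii; exists 0, (fun => 0) => x; exists (fun=> 0).
  by rewrite big_ord0; apply: ii; rewrite linear0; apply/rowP => -[].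
have [|u uE] := @linear_ex R R^o 'rV[R]_(1 + n) (fun r => row_mx (const_mx r) 0).
  move=> a x y; rewrite scale_row_mx add_row_mx scaler0 addr0; congr row_mx.
  by apply/rowP => i; rewrite !mxE.
have [|v vE] := @linear_ex R 'rV[R]_(1 + n) 'rV[R]_n rsubmx; first exact: linearP.
apply: (@noetherian_ext R^o 'rV[R]_(1 + n) 'rV[R]_n u v) => //; last first.
  exact: noetherian_regular.
move=> y; rewrite vE; split=> [y0|[x <-]]; last by rewrite uE row_mxKr.
exists (lsubmx y 0 0); rewrite uE -[RHS]hsubmxK y0; congr row_mx.
by apply/rowP => i; rewrite !mxE !ord1.
Qed.

Lemma fg_presentation M : finitely_generated M ->
  exists n (K : lmodType R) (u : {linear K -> 'rV[R]_n.+1}) v,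
    short_exact u (v : {linear _ -> M}) /\ finitely_generated K.
Proof.
move=> /fg_cover[n [v vs]]; have [K [u [ui uv]]] := kernel_ex v.
by exists n, K, u, v; split=> //; exact: noetherian_rV ui.
Qed.

End Noetherian.

(** * Resolutions and vanishing of Ext *)

Section Resolutions.
Variable R : comNzRingType.
Hypothesis R_noetherian : noetherian_ring R.
Implicit Types M N P Q K : lmodType R.

Record cover_step K := CoverStep {
  step_rank : nat;
  step_ker : lmodType R;
  step_in : {linear step_ker -> 'rV[R]_step_rank};
  step_out : {linear 'rV[R]_step_rank -> K};
  step_exact : short_exact step_in step_out;
  step_fg : finitely_generated step_ker
}.

Lemma projective_resolution_ex M :
  finitely_generated M -> inhabited (projective_resolution M).
Proof.
move=> Mfg; pose fgmod := {K : lmodType R | finitely_generated K}.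
have step (K : fgmod) : inhabited (cover_step (sval K)).
  have [n [K' [u [v [se fg]]]]] := fg_presentation R_noetherian (svalP K).
  by constructor; exact: CoverStep se fg.
pose st (K : fgmod) := inhabited_witness (step K).
pose next (K : fgmod) : fgmod := exist _ _ (step_fg (st K)).
(* [S i] is the i-th syzygy of [M]; the differential maps onto [S i.+1] and then embeds it in the
   free cover of [S i]. *)
pose S i : fgmod := iter i next (exist _ M Mfg).
pose P i : lmodType R := 'rV[R]_(step_rank (st (S i))).
pose d i : {linear P i.+1 -> P i} :=
  (step_in (st (S i)) \o step_out (st (S i.+1)) : {linear _ -> _}).
constructor; apply: (@ProjectiveResolution R M P d (step_out (st (S 0%N)))).
- by move=> i; exact: projective_rV.
- by have [] := step_exact (st (S 0%N)).
- have [_ e0 _] := step_exact (st (S 0%N)).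
  have [_ _ s1] := step_exact (st (S 1%N)) => y; rewrite e0.
  split=> [[x <-]|[x <-]]; last by eexists.
  by have [z <-] := s1 x; exists z.
- move=> i y; have [i0 _ _] := step_exact (st (S i)).
  have [_ e1 _] := step_exact (st (S i.+1)).
  have [_ _ s2] := step_exact (st (S i.+2)).
  have -> : d i y = 0 <-> step_out (st (S i.+1)) y = 0.
    split=> [|/= ->]; last by rewrite linear0.
    by move=> /= y0; apply: i0; rewrite y0 linear0.
  rewrite e1; split=> [[x <-]|[x <-]]; last by eexists.
  by have [z <-] := s2 x; exists z.
Qed.

Section Splice.
Variables (M P K : lmodType R) (u : {linear K -> P}) (v : {linear P -> M}).
Hypotheses (P_proj : projective_module P) (uv : short_exact u v).
Variable Q : projective_resolution K.

Let splice_mod i : lmodType R := if i is j.+1 then pres Q j else P.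

Let splice_d i : {linear splice_mod i.+1 -> splice_mod i} :=
  match i with
  | 0 => (u \o pres_aug Q : {linear _ -> _})
  | j.+1 => pres_d Q j
  end.

Let splice_proj i : projective_module (splice_mod i).
Proof. by case: i => [|i] //=; exact: pres_proj. Qed.

Let splice_exact0 : exact_at (splice_d 0) v.
Proof.
have [_ ex _] := uv => y; rewrite ex; split=> [[x <-]|[x <-]]; last by eexists.
by have [z <-] := pres_surj Q x; exists z.
Qed.

Let splice_exact i : exact_at (splice_d i.+1) (splice_d i).
Proof.
have [ui _ _] := uv; case: i => [|i] /=; last exact: pres_exact.
move=> y; rewrite -(pres_exact0 (p := Q) y) /=.
by split=> [y0|->]; [apply: ui; rewrite y0|]; rewrite linear0.
Qed.

Definition splice : projective_resolution M :=
  let: And3 _ _ vs := uv in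
  ProjectiveResolution splice_proj vs splice_exact0 splice_exact.

(** Dimension shift: degree [i.+1] of the spliced resolution is degree [i] of [Q], with the same
    cocycles and, for [i > 0], the same coboundaries. *)
Lemma Ext_vanishes_kernel i N :
  (0 < i)%N -> Ext_vanishes i.+1 M N ->
  forall g : {linear pres Q i -> N},
    (forall x, g (pres_d Q i x) = 0) -> coboundary g.
Proof.
case: i => // i _ /(_ splice); rewrite /splice; case: uv => ? ? ? E g gd.
exact: (E g gd).
Qed.

(** Composed with the augmentation of [Q], [g] is a 1-cocycle of the spliced resolution; a cochain
    on [P] bounding it is the extension. *)
Lemma Ext1_extend_resolved N (g : {linear K -> N}) : Ext_vanishes 1 M N ->
  exists h : {linear P -> N}, forall x, h (u x) = g x.
Proof.
move=> /(_ splice); rewrite /splice; case: uv => ? ? ? E.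
have [|h hE] := E (g \o pres_aug Q : {linear _ -> _}).
  move=> x /=; have -> : pres_aug Q (pres_d Q 0%N x) = 0; last by rewrite linear0.
  by apply/pres_exact0; exists x.
by exists h => x; have [y <-] := pres_surj Q x; rewrite -hE.
Qed.

End Splice.

Lemma Ext1_extend M N P K (u : {linear K -> P}) (v : {linear P -> M})
    (g : {linear K -> N}) :
    finitely_generated K -> projective_module P -> short_exact u v ->
    Ext_vanishes 1 M N ->
  exists h : {linear P -> N}, forall x, h (u x) = g x.
Proof.
move=> /projective_resolution_ex[Q] Pp uv E.
exact: (Ext1_extend_resolved Pp uv Q g E).
Qed.

End Resolutions.

(** * Vanishing of Ext from finite injective dimension *)

Section ExtVanishing.
Variable R : comNzRingType.
Implicit Types A B C J K L M N P : lmodType R.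

(* Ext^1(K, N) = 0: A maps onto the kernel of v, and g factors through its
   image in B. *)
Definition extendable K N := forall A B (u : {linear A -> B}) (v : {linear B -> K})
    (g : {linear A -> N}),
  exact_at u v -> (forall y, exists x, v x = y) -> (forall x, u x = 0 -> g x = 0) ->
  exists h : {linear B -> N}, forall x, h (u x) = g x.

Fixpoint inj_dim_le n N : Prop :=
  if n is p.+1 then
    exists J C (u : {linear N -> J}) (v : {linear J -> C}),
      [/\ short_exact u v, injective_module J & inj_dim_le p C]
  else injective_module N.

(* Retracts are included so that summands inherit the property. *)
Inductive syzygy : nat -> lmodType R -> Prop :=
| Syzygy0 K : syzygy 0 K
| SyzygyS n K P M (u : {linear K -> P}) (v : {linear P -> M}) :
    short_exact u v -> projective_module P -> syzygy n M -> syzygy n.+1 K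
| SyzygyRetract n K L (i : {linear K -> L}) (p : {linear L -> K}) :
    (forall x, p (i x) = x) -> syzygy n L -> syzygy n K.

(** Ext^1(K, N) is the cokernel of Hom(K, J) -> Hom(K, C), so this is its vanishing seen from an
    injective embedding of [N]. *)
Definition liftable K N := exists J C (u : {linear N -> J}) (v : {linear J -> C}),
  [/\ short_exact u v, injective_module J &
      forall f : {linear K -> C}, exists h : {linear K -> J}, forall x, v (h x) = f x].

(** Extend [g] to [H : B -> J]. Modulo [N], [H] factors through [K] as a map [f]; subtracting from
    [H] a lift of [f] leaves a map into [N] that still extends [g]. *)
Lemma liftable_extendable K N : liftable K N -> extendable K N.
Proof.
move=> [J [C [e [p [[ei ep ps] Ji lift]]]]] A B u v g uv vs ug.
have [B' [i [g' [q [ii iv iq gq qs]]]]] := factor_exact uv ug.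
have [H HE] := Ji _ _ i (e \o g' : {linear _ -> _}) ii.
have [|f fE] := @factor_surj R B K C v (p \o H : {linear _ -> _}) vs.
  move=> x /iv[y <-] /=; rewrite HE /=; apply/ep; by eexists.
have [h hE] := lift f.
have [|r rE] := @factor_inj R B N J e (H \- (h \o v) : {linear _ -> _}) ei.
  by move=> x; apply/ep; rewrite /= linearB hE fE subrr.
exists r => x; apply: ei; rewrite rE /= -iq HE /= gq.
have -> : v (i (q x)) = 0 by apply/iv; eexists.
by rewrite linear0 subr0.
Qed.

(** Each syzygy on the left is traded for a cosyzygy on the right: a map [K -> C] extends to [P] by
    induction for [M] and [C], then lifts to [J] as [P] is projective. After [n] trades the module
    on the right is injective. *)
Lemma syzygy_liftable n N K : inj_dim_le n N -> syzygy n K -> liftable K N.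
Proof.
move=> + Kn; elim: Kn N => {n K}.
- move=> K N /= Ni; exists N, 'rV[R]_0, idfun, (\0 : {linear _ -> _}); split=> //.
  + split=> // [y|z]; first by split=> // _; exists y.
    by exists 0; apply/rowP => -[].
  + by move=> f; exists (\0 : {linear _ -> _}) => x; apply/rowP => -[].
- move=> n K P M u v [ui uv vs] Pp _ IH N [J [C [e [p [[ei ep ps] Ji Cn]]]]].
  exists J, C, e, p; split=> // f.
  have [|h hE] := liftable_extendable (IH _ Cn) (g := f) uv vs.
    by move=> x ux0; rewrite (ui x 0) ?linear0 // ux0 linear0.
  have [l lE] := Pp _ _ p h ps.
  by exists (l \o u : {linear _ -> _}) => x; rewrite /= lE hE.
- move=> n K L i p ip _ IH N /IH[J [C [e [q [se Ji lift]]]]].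
  exists J, C, e, q; split=> // f.
  have [h hE] := lift (f \o p : {linear _ -> _}).
  by exists (h \o i : {linear _ -> _}) => x; rewrite /= hE /= ip.
Qed.

Lemma finite_inj_dim_le N :
  finite_injective_dimension N -> exists n, inj_dim_le n N.
Proof.
(* Vanishing of [J i] is given for [i > n], hence the bound [n.+1]: the last cosyzygy embeds in
   [J n.+1 = 0]. *)
move=> [J [eps [d [n [Ji epsi eps0 dd Jn]]]]]; exists n.+1.
suff H k i N' (e : {linear N' -> J i}) : (k + i = n.+1)%N -> injective e ->
    exact_at e (d i) -> inj_dim_le k N' by apply: (H n.+1 0%N _ eps); rewrite ?addn0.
elim: k i N' e => [|k IHk] i N' e.
  rewrite add0n => i_eq ei _ A B u g _; exists (\0 : {linear _ -> _}) => x.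
  by apply: ei; transitivity (0 : J i); [|apply: esym]; apply: Jn; rewrite i_eq.
rewrite addSnnS => ki ei ed /=; have [C [c [ci cd]]] := kernel_ex (d i.+1).
have [|p pE] := @factor_inj R (J i) C (J i.+1) c (d i) ci.
  by move=> x; apply/cd/dd; exists x.
exists (J i), C, e, p; split=> //; last exact: IHk cd.
split=> // [y|z].
  rewrite -(ed y) -pE; split=> [->|p0]; first by rewrite linear0.
  by apply: ci; rewrite p0 linear0.
have /dd[x xE] : d i.+1 (c z) = 0 by apply/cd; exists z.
by exists x; apply: ci; rewrite pE.
Qed.

(** [S] is the j-th syzygy of [K] in [P]. Each step raises the order by one, so being a syzygy of
    every order is preserved. *)
Lemma resolution_syzygy K (P : projective_resolution K) :
    (forall n, syzygy n K) ->
  forall j, exists (S : lmodType R) (p : {linear pres P j -> S}),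
    [/\ exact_at (pres_d P j) p, forall y, exists x, p x = y &
        forall n, syzygy n S].
Proof.
move=> Ks; elim=> [|j [S [p [dp ps Ss]]]].
  by exists K, (pres_aug P); split=> //; [exact: pres_exact0 | exact: pres_surj].
have [S' [i [ii ip]]] := kernel_ex p.
have [|q qE] := @factor_inj R (pres P j.+1) S' (pres P j) i (pres_d P j) ii.
  by move=> x; apply/ip/dp; exists x.
exists S', q; split.
- move=> y; rewrite -(pres_exact (p := P) (i := j) y) -qE.
  split=> [->|q0]; first by rewrite linear0.
  by apply: ii; rewrite q0 linear0.
- move=> y; have /dp[x xE] : p (i y) = 0 by apply/ip; exists y.
  by exists x; apply: ii; rewrite qE.
- case=> [|n]; first exact: Syzygy0.
  by apply: (SyzygyS (u := i) (v := p)) => //; exact: pres_proj.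
Qed.

Lemma syzygy_Ext_vanishes n N K : inj_dim_le n N -> (forall m, syzygy m K) ->
  forall i, (0 < i)%N -> Ext_vanishes i K N.
Proof.
(* A cocycle in degree [i.+1] kills the kernel of [pres_d P i], so it extends along this map because
   Ext^1 of the cokernel [S] vanishes. *)
move=> Nn Ks [//|i] _ P g gd; have [S [p [dp ps Ss]]] := resolution_syzygy P Ks i.
have [|h hE] := liftable_extendable (syzygy_liftable Nn (Ss n)) (g := g) dp ps.
  by move=> x /pres_exact[y <-]; exact: gd.
by exists h => x; rewrite hE.
Qed.

Lemma syzygy_extendable n N K : inj_dim_le n N -> (forall m, syzygy m K) ->
  extendable K N.
Proof. by move=> Nn Ks; exact: liftable_extendable (syzygy_liftable Nn (Ks n)). Qed.

Lemma projective_syzygy P n : projective_module P -> syzygy n P.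
Proof.
have syz0 m : syzygy m 'rV[R]_0.
  elim: m => [|m IH]; first exact: Syzygy0.
  apply: (SyzygyS (u := idfun) (v := idfun)) (@projective_rV R 0) IH.
  split=> // [y|z]; last by exists z.
  by split=> _; [exists y|]; apply/rowP => -[].
case: n => [|n] Pp; first exact: Syzygy0.
apply: (SyzygyS (u := idfun) (v := (\0 : {linear _ -> 'rV[R]_0}))) => //.
by split=> // [y|z]; [split=> // _; exists y | exists 0; apply/rowP => -[]].
Qed.

End ExtVanishing.

(** * Duality of Cohen-Macaulay modules *)

Section Duality.
Variable R : comNzRingType.
Implicit Types D E K M P Z : lmodType R.

Definition is_CM M :=
  finitely_generated M /\ forall i, (0 < i)%N -> Ext_vanishes i M R^o.

Lemma CM_is_CM (M : CM R) : is_CM M.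
Proof. by split; [exact: CM_fg | exact: CM_ext]. Qed.

(* b identifies D with the dual of M. *)
Definition dual_pairing M D (b : D -> M -> R^o) : Prop :=
  [/\ forall d, linear (b d), forall m, linear (fun d => b d m),
      forall d, (forall m, b d m = 0) -> d = 0 &
      forall f : {linear M -> R^o}, exists d, forall m, b d m = f m].

Definition dotv n (x y : 'rV[R]_n) : R := \sum_i x 0 i * y 0 i.

Lemma dotv_linear n (x : 'rV[R]_n) : linear (dotv x : 'rV[R]_n -> R^o).
Proof.
move=> a y z; rewrite scaler_sumr -big_split; apply: eq_bigr => i _ /=.
by rewrite !mxE mulrDr mulrCA.
Qed.

Lemma dotvC n (x y : 'rV[R]_n) : dotv x y = dotv y x.
Proof. by apply: eq_bigr => i _; rewrite mulrC. Qed.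

Lemma dotv_delta n (x : 'rV[R]_n) i : dotv x (delta_mx 0 i) = x 0 i.
Proof.
rewrite /dotv (bigD1 i) //= mxE !eqxx mulr1 big1 ?addr0 // => j ji.
by rewrite mxE (negPf ji) mulr0.
Qed.

Lemma dotv_row n (h : {linear 'rV[R]_n -> R^o}) x :
  h x = dotv (\row_i h (delta_mx 0 i)) x.
Proof.
by rewrite linear_rVE; apply: eq_bigr => i _; rewrite mxE mulrC.
Qed.

(** Hom(-, R) is left exact, and the extension hypothesis, which amounts to Ext^1(M, R) = 0, makes
    [t] onto. Free modules are self-dual by [dotv]; the two formulas say that [s] and [t] are the
    transposes of [v] and [u]. *)
Lemma dual_sequence M D K E n (b : D -> M -> R^o) (c : E -> K -> R^o)
    (u : {linear K -> 'rV[R]_n}) (v : {linear 'rV[R]_n -> M}) :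
    dual_pairing b -> dual_pairing c -> short_exact u v ->
    (forall g : {linear K -> R^o}, exists h : {linear 'rV[R]_n -> R^o},
       forall x, h (u x) = g x) ->
  exists (s : {linear D -> 'rV[R]_n}) (t : {linear 'rV[R]_n -> E}),
    [/\ short_exact s t, forall d x, b d (v x) = dotv (s d) x &
        forall x k, c (t x) k = dotv x (u k)].
Proof.
move=> [bl br b0 bs] [cl cr c0 cs] [ui uv vs] ext.
have [|s sE] := @linear_ex R D 'rV[R]_n (fun d => \row_i b d (v (delta_mx 0 i))).
  by move=> a d d'; apply/rowP => i; rewrite !mxE br.
have bsE d x : b d (v x) = dotv (s d) x.
  have [g gE] := linear_ex (bl d).
  by rewrite sE -gE -[g (v x)]/((g \o v : {linear _ -> R^o}) x) dotv_row;
     congr dotv; apply/rowP => i; rewrite !mxE /= gE.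
have [t' t'E] : {t : 'rV[R]_n -> E & forall x k, c (t x) k = dotv x (u k)}.
  apply: (@choice _ _ (fun x e => forall k, c e k = dotv x (u k))) => x.
  have [f fE] := linear_ex (dotv_linear x).
  have [e eE] := cs (f \o u : {linear _ -> _}).
  by exists e => k; rewrite eE /= fE.
have c_inj e e' : (forall k, c e k = c e' k) -> e = e'.
  move=> ee'; apply/eqP; rewrite -subr_eq0; apply/eqP/c0 => k.
  have := cr k (-1) e' e; rewrite /= scaleN1r [- e' + e]addrC => ->.
  by rewrite ee' scaleN1r addNr.
have [|t tE] := @linear_ex R 'rV[R]_n E t'.
  move=> a x y; apply: c_inj => k; rewrite cr !t'E dotvC dotv_linear.
  by rewrite ![dotv (u k) _]dotvC.
exists s, t; split=> [||x k]; [|exact: bsE|by rewrite tE t'E].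
have inj0 d : s d = 0 -> d = 0.
  move=> sd; apply: b0 => m; have [x <-] := vs m; rewrite bsE sd.
  by rewrite /dotv big1 // => i _; rewrite mxE mul0r.
split=> [d d' dd'|x|e].
- by apply/eqP; rewrite -subr_eq0; apply/eqP/inj0; rewrite linearB dd' subrr.
- split=> [tx|[d <-]]; last first.
    rewrite tE; apply: c0 => k; rewrite t'E -bsE.
    have -> : v (u k) = 0 by apply/uv; exists k.
    by have [g <-] := linear_ex (bl d); rewrite linear0.
  have [f fE] := linear_ex (dotv_linear x).
  have [|g gE] := @factor_surj R _ M R^o v f vs.
    move=> y /uv[k <-]; rewrite fE -t'E -tE tx.
    by have [h <-] := linear_ex (cr k); rewrite linear0.
  have [d dE] := bs g; exists d; apply/rowP => i.
  by rewrite -dotv_delta -bsE dE gE fE dotv_delta.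
- have [g gE] := linear_ex (cl e); have [h hE] := ext g.
  exists (\row_i h (delta_mx 0 i)); apply: c_inj => k.
  by rewrite tE t'E -dotv_row hE gE.
Qed.

Hypothesis R_noetherian : noetherian_ring R.

(** A functional is determined by its values on generators, so the dual is the submodule [T] of a
    finite free module, and is finitely generated by noetherianity. *)
Lemma dual_ex M : finitely_generated M ->
  exists D (b : D -> M -> R^o), dual_pairing b /\ finitely_generated D.
Proof.
move=> /fg_cover[n [v vs]].
pose T := [set r : 'rV[R]_n.+1 | exists f : {linear M -> R^o},
  forall i, r 0 i = f (v (delta_mx 0 i))].
have [||D [s [si sP]]] := @submod_ex R _ T.
- by exists (\0 : {linear _ -> _}) => i; rewrite mxE.
- move=> a x y [f fE] [g gE].
  exists (a \*: f \+ g : {linear _ -> _}) => i.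
  by rewrite !mxE fE gE.
have s_dual d : exists f : {linear M -> R^o}, forall i, s d 0 i = f (v (delta_mx 0 i)).
  by apply/sP; exists d.
have [b bE] := choice s_dual.
have bsE d x : b d (v x) = dotv (s d) x.
  rewrite -[b d (v x)]/((b d \o v : {linear _ -> R^o}) x) dotv_row.
  by congr dotv; apply/rowP => i; rewrite !mxE /= bE.
exists D, b; split; last exact: noetherian_rV si.
split=> [d|m|d d0|f]; first exact: linearP.
- by move=> a x y; have [c <-] := vs m; rewrite !bsE linearP !(dotvC _ c) dotv_linear.
- by apply: si; rewrite linear0; apply/rowP => i; rewrite bE d0 mxE.
- have /sP[d dE] : T (\row_i f (v (delta_mx 0 i))) by exists f => i; rewrite mxE.
  exists d => m; have [c <-] := vs m; rewrite bsE dE.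
  by rewrite -[f (v c)]/((f \o v : {linear _ -> R^o}) c) [RHS]dotv_row.
Qed.

Lemma is_CM_kernel K P M (u : {linear K -> P}) (v : {linear P -> M}) :
    short_exact u v -> projective_module P -> finitely_generated K ->
  is_CM M -> is_CM K.
Proof.
move=> uv Pp Kfg [Mfg E]; split=> // i i0 Q.
exact: (Ext_vanishes_kernel Pp uv i0 (E _ _)).
Qed.

(** Dualizing a presentation of [M] exhibits [D] as a syzygy of the dual of [K], and [K] is again
    Cohen-Macaulay. *)
Lemma dual_syzygy m M D (b : D -> M -> R^o) :
  is_CM M -> dual_pairing b -> syzygy m D.
Proof.
elim: m M D b => [|m IHm] M D b MCM bd; first exact: Syzygy0.
have [n [K [u [v [uv Kfg]]]]] := fg_presentation R_noetherian MCM.1.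
have [E [c [cd _]]] := dual_ex Kfg.
have KCM := is_CM_kernel uv (@projective_rV R _) Kfg MCM.
have [|s [t [st _ _]]] := dual_sequence bd cd uv.
  by move=> g; apply: (Ext1_extend R_noetherian g Kfg _ uv) (MCM.2 1%N _) => //;
     exact: projective_rV.
exact: SyzygyS st (@projective_rV R _) (IHm _ _ _ KCM cd).
Qed.

Variable d : nat.
Hypothesis R_inj_dim : inj_dim_le d R^o.

Lemma is_CM_syzygy M : finitely_generated M -> (forall n, syzygy n M) -> is_CM M.
Proof. by move=> Mfg Ms; split=> //; exact: syzygy_Ext_vanishes R_inj_dim Ms. Qed.

(** The cokernel [E] of [s], the dual of [K], satisfies Ext^1(E, R) = 0, so [f] extends along [s] to
    a functional on the free module. This is the dot product with some vector, whose image under [v]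
    represents [f]. *)
Lemma reflexive_surj M D (b : D -> M -> R^o) : is_CM M -> dual_pairing b ->
  forall f : {linear D -> R^o}, exists m, forall x, b x m = f x.
Proof.
move=> MCM bd f.
have [n [K [u [v [uv Kfg]]]]] := fg_presentation R_noetherian MCM.1.
have [E [c [cd _]]] := dual_ex Kfg.
have KCM := is_CM_kernel uv (@projective_rV R _) Kfg MCM.
have [|s [t [[si st ts] bE _]]] := dual_sequence bd cd uv.
  by move=> g; apply: (Ext1_extend R_noetherian g Kfg _ uv) (MCM.2 1%N _) => //;
     exact: projective_rV.
have Eext := syzygy_extendable R_inj_dim (fun n => dual_syzygy n KCM cd).
have [|h hE] := Eext _ _ s t f st ts.
  by move=> x sx0; rewrite (si x 0) ?linear0 // sx0 linear0.
exists (v (\row_i h (delta_mx 0 i))) => x.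
by rewrite bE dotvC -dotv_row hE.
Qed.

(** If [v y] pairs to 0 with [D], the dot product with [y] descends to the dual [E] of [K]. There it
    is evaluation at some [k] by surjectivity for [K], so [y = u k] and [v y = 0]. *)
Lemma reflexive_inj M D (b : D -> M -> R^o) : is_CM M -> dual_pairing b ->
  forall m, (forall x, b x m = 0) -> m = 0.
Proof.
move=> MCM bd m m0.
have [n [K [u [v [uv Kfg]]]]] := fg_presentation R_noetherian MCM.1.
have [E [c [cd _]]] := dual_ex Kfg.
have KCM := is_CM_kernel uv (@projective_rV R _) Kfg MCM.
have [|s [t [[si st ts] bE cE]]] := dual_sequence bd cd uv.
  by move=> g; apply: (Ext1_extend R_noetherian g Kfg _ uv) (MCM.2 1%N _) => //;
     exact: projective_rV.
have [ui uex vs] := uv.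
have [y yE] := vs m; have [f fE] := linear_ex (dotv_linear y).
have [|g gE] := @factor_surj R _ E R^o t f ts.
  by move=> x /st[z <-]; rewrite fE dotvC -bE yE m0.
have [k kE] := reflexive_surj KCM cd g.
rewrite -yE; apply/uex; exists k; apply/rowP => i.
by rewrite -!dotv_delta dotvC -cE kE gE fE.
Qed.

(** Dualize a presentation of the dual [D] of [Z]: by reflexivity the sequence starts with [Z], and
    its last term is Cohen-Macaulay as the dual of [L]. *)
Lemma cosyzygy_ex Z : is_CM Z ->
  exists n (C : lmodType R) (u : {linear Z -> 'rV[R]_n}) (v : {linear 'rV[R]_n -> C}),
    short_exact u v /\ is_CM C.
Proof.
move=> ZCM; have [D [b [bd Dfg]]] := dual_ex ZCM.1.
have DCM : is_CM D by apply: is_CM_syzygy => // n; exact: dual_syzygy bd.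
have [n [L [u [v [uv Lfg]]]]] := fg_presentation R_noetherian Dfg.
have LCM := is_CM_kernel uv (@projective_rV R _) Lfg DCM.
have [C [c [cd Cfg]]] := dual_ex Lfg.
have [||s [t [st _ _]]] := @dual_sequence D Z L C _ (fun z x => b x z) c u v _ cd uv.
- have [bl br b0 bs] := bd; split=> [z|x|z z0|f]; first exact: br.
  + exact: bl.
  + exact: reflexive_inj z0.
  + exact: reflexive_surj.
- by move=> g; apply: (Ext1_extend R_noetherian g Lfg _ uv) (DCM.2 1%N _) => //;
     exact: projective_rV.
exists n.+1, C, s, t; split=> //.
by apply: is_CM_syzygy => // m; exact: dual_syzygy cd.
Qed.

Lemma CM_syzygy n Z : is_CM Z -> syzygy n Z.
Proof.
elim: n Z => [|n IHn] Z ZCM; first exact: Syzygy0.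
have [m [C [u [v [uv CCM]]]]] := cosyzygy_ex ZCM.
exact: SyzygyS uv (@projective_rV R _) (IHn _ CCM).
Qed.

Lemma CM_extendable Z : is_CM Z -> extendable Z R^o.
Proof. by move=> ZCM; apply: syzygy_extendable R_inj_dim _ => n; exact: CM_syzygy. Qed.

Lemma is_CM_retract K M (i : {linear K -> M}) (p : {linear M -> K}) :
  (forall x, p (i x) = x) -> is_CM M -> is_CM K.
Proof.
move=> ip MCM; apply: is_CM_syzygy => [|n].
  by apply: (fg_surj (v := p)) MCM.1 => y; exists (i y).
exact: SyzygyRetract ip (CM_syzygy n MCM).
Qed.

Lemma is_CM_rV n : is_CM 'rV[R]_n.
Proof.
apply: is_CM_syzygy; first by apply: (fg_rV (v := idfun)) => y; exists y.
by move=> m; apply: projective_syzygy; exact: projective_rV.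
Qed.

End Duality.

(** * Lifting idempotents over a complete local ring *)

Section CompleteLocal.
Variable R : comNzRingType.
Implicit Types I J : set R.

Lemma ideal_sum I n (F : 'I_n -> R) : is_ideal I -> (forall i, I (F i)) ->
  I (\sum_i F i).
Proof. by move=> [I0 ID _] IF; elim/big_ind: _. Qed.

Lemma ideal_mul_ideal I J : is_ideal I -> is_ideal (ideal_mul I J).
Proof.
move=> [I0 ID IM]; split.
- by exists 0, (fun=> 0), (fun=> 0); split=> [[]|]; rewrite ?big_ord0.
- move=> _ _ [n [a [b [ab ->]]]] [n' [a' [b' [ab' ->]]]].
  pose f (g : 'I_n -> R) (g' : 'I_n' -> R) (i : 'I_(n + n')) :=
    match fintype.split i with inl j => g j | inr j => g' j end.
  exists (n + n')%N, (f a a'), (f b b'); split.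
    by move=> i; rewrite /f; case: fintype.split.
  rewrite big_split_ord /=; congr (_ + _); apply: eq_bigr => i _; rewrite /f.
    by rewrite -[lshift _ _]/(unsplit (inl i)) unsplitK.
  by rewrite -[rshift _ _]/(unsplit (inr i)) unsplitK.
- move=> r _ [n [a [b [ab ->]]]]; exists n, (fun i => r * a i), b; split.
    by move=> i; have [Ia Jb] := ab i; split=> //; exact: IM.
  by rewrite mulr_sumr; apply: eq_bigr => i _; rewrite mulrA.
Qed.

Lemma ideal_exp_ideal I n : is_ideal (ideal_exp I n).
Proof. by elim: n => [|n IHn] /=; [split | exact: ideal_mul_ideal]. Qed.

Lemma ideal_expM I n x y : ideal_exp I n x -> I y -> ideal_exp I n.+1 (x * y).
Proof. by exists 1, (fun=> x), (fun=> y); rewrite big_ord1. Qed.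

Lemma ideal_expS I n x : ideal_exp I n.+1 x -> ideal_exp I n x.
Proof.
move=> [k [a [b [ab ->]]]]; have II := ideal_exp_ideal I n.
apply: ideal_sum => // i; rewrite mulrC.
by have [_ _ IM] := II; apply: IM; have [] := ab i.
Qed.

Lemma ideal_exp_sub I n x : is_ideal I -> ideal_exp I n.+1 x -> I x.
Proof.
move=> II [k [a [b [ab ->]]]]; apply: ideal_sum => // i.
by have [_ _ IM] := II; apply: IM; have [] := ab i.
Qed.

Definition poly_in I (p : {poly R}) := forall i, I p`_i.

Lemma poly_inM I p q : is_ideal I -> poly_in I p -> poly_in I (p * q).
Proof.
move=> II Ip i; rewrite coefM; apply: ideal_sum => // j.
by rewrite mulrC; have [_ _ IM] := II; exact: IM.
Qed.

(** Reduction by a monic polynomial is linear over [R], so the remainder is a combination of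
    remainders of powers of X with coefficients in [I]. *)
Lemma poly_in_rmodp I p d : d \is monic -> is_ideal I ->
  poly_in I p -> poly_in I (Pdiv.Ring.rmodp p d).
Proof.
move=> dm II Ip i; rewrite -[p]coefK poly_def Pdiv.RingMonic.rmodp_sum // coef_sum.
apply: ideal_sum => // j; rewrite Pdiv.RingMonic.rmodpZ // coefZ mulrC.
by have [_ _ IM] := II; exact: IM.
Qed.

Variable m : set R.
Hypothesis m_max : maximal_ideal m.
Hypothesis m_complete : adically_complete m.

Let m_ideal : is_ideal m. Proof. by have [] := m_max. Qed.

(** * The m-adic filtration on R[X]/(d) *)

Section ModMonic.
Variable d : {poly R}.
Hypothesis d_monic : d \is monic.
Local Notation rem p := (Pdiv.Ring.rmodp p d).

(* The n-th power of the ideal generated by m in R[X]/(d). *)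
Definition adic n p := poly_in (ideal_exp m n) (rem p).

Lemma adicD n p q : adic n p -> adic n q -> adic n (p + q).
Proof.
move=> pn qn i; rewrite Pdiv.RingMonic.rmodpD // coefD.
by have [_ ID _] := ideal_exp_ideal m n; exact: ID.
Qed.

Lemma adicMr n p q : adic n p -> adic n (p * q).
Proof.
move=> pn; rewrite /adic -Pdiv.RingMonic.rmodp_mulml //.
by apply: poly_in_rmodp; rewrite ?d_monic //; [|apply: poly_inM => //];
   exact: ideal_exp_ideal.
Qed.

Lemma adicMl n p q : adic n p -> adic n (q * p).
Proof. by rewrite mulrC; exact: adicMr. Qed.

Lemma adicB n p q : adic n p -> adic n q -> adic n (p - q).
Proof. by move=> pn qn; apply: adicD => //; rewrite -mulN1r; exact: adicMl. Qed.

Lemma adicS n p : adic n.+1 p -> adic n p.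
Proof. by move=> pn i; exact: ideal_expS. Qed.

Lemma adicSM n p q : adic n p -> adic 1 q -> adic n.+1 (p * q).
Proof.
move=> pn q1; rewrite /adic -Pdiv.RingMonic.rmodp_mulml //.
rewrite -Pdiv.RingMonic.rmodp_mulmr //.
apply: poly_in_rmodp => //; first exact: ideal_exp_ideal.
move=> i; rewrite coefM; apply: ideal_sum => [|j]; first exact: ideal_exp_ideal.
by apply: ideal_expM; [exact: pn | exact: (ideal_exp_sub (n := 0))].
Qed.

Lemma adic_multiple n p : adic n (p * d).
Proof.
move=> i; rewrite Pdiv.RingMonic.rmodp_mull // coef0.
by have [] := ideal_exp_ideal m n.
Qed.

Lemma adic0 p : adic 0 p. Proof. by []. Qed.

Lemma adic1 p : poly_in m p -> adic 1 p.
Proof.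
move=> pm; apply: poly_in_rmodp => //; first exact: ideal_exp_ideal.
by move=> i; rewrite -[p`_i]mul1r; exact: ideal_expM.
Qed.

Lemma adic_separated p : (forall n, adic n p) -> exists q, p = q * d.
Proof.
move=> pn; exists (Pdiv.Ring.rdivp p d).
rewrite {1}(Pdiv.RingMonic.rdivp_eq d_monic p); apply/eqP.
rewrite addrC -subr_eq0 addrK; apply/eqP/polyP => i; rewrite coef0.
by apply: m_complete.1 => n; exact: pn.
Qed.

Lemma adic_limit (P : nat -> {poly R}) : (forall n, adic n (P n.+1 - P n)) ->
  exists p, forall n, adic n (p - P n).
Proof.
move=> Pn.
have lim i : exists y, forall n, ideal_exp m n (y - (rem (P n))`_i).
  apply: m_complete.2 => n; rewrite -coefB -Pdiv.RingMonic.rmodpB //; exact: Pn.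
have [y yE] := choice lim.
(* Remainders have size below [size d], so their coefficientwise limit may be truncated there. *)
exists (\poly_(i < size d) y i) => n.
have rE : rem (P n - rem (P n)) = 0.
  by rewrite Pdiv.RingMonic.rmodpB // Pdiv.RingMonic.rmodp_id // subrr.
rewrite -[P n](subrK (rem (P n))) opprD addrCA addrC; apply: adicB; last first.
  by move=> i; rewrite rE coef0; have [] := ideal_exp_ideal m n.
apply: poly_in_rmodp => //; first exact: ideal_exp_ideal.
move=> i; rewrite coefB coef_poly; case: ltnP => [_|di]; first exact: yE.
have rd : (size (rem (P n)) <= i)%N.
  by apply: leq_trans di; rewrite ltnW // Pdiv.Ring.ltn_rmodpN0 // monic_neq0.
by rewrite nth_default // subrr; have [] := ideal_exp_ideal m n.
Qed.

(** The inverse of [1 - p] modulo [d] is the limit of the geometric series. *)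
Lemma adic_unit p : adic 1 p -> exists q s, (1 - p) * q = 1 + s * d.
Proof.
move=> p1.
have pX n : adic n (p ^+ n).
  by elim: n => [|n IHn]; [exact: adic0 | rewrite exprSr; exact: adicSM].
have [|q qE] := @adic_limit (fun n => \sum_(i < n) p ^+ i).
  by move=> n; rewrite big_ord_recr /= [X in X - _]addrC addrK.
have [n|s sE] := @adic_separated ((1 - p) * q - 1); last first.
  by exists q, s; rewrite -sE addrCA subrr addr0.
have -> : (1 - p) * q - 1 = (1 - p) * (q - \sum_(i < n) p ^+ i) - p ^+ n.
  rewrite mulrBr; have -> : (1 - p) * (\sum_(i < n) p ^+ i) = 1 - p ^+ n.
    by rewrite -opprB mulNr -subrX1 opprB.
  by rewrite opprB addrA addrAC addrK.
by apply: adicB => //; exact: adicMl.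
Qed.

Lemma adic_idempotent p : adic 1 (p ^+ 2 - p) ->
  exists q s, adic 1 (q - p) /\ q ^+ 2 - q = s * d.
Proof.
(* Iterating 3x^2 - 2x^3 lifts idempotents: by [fI] the defect x^2 - x becomes a multiple of its
   square, and by [fB] each step moves x by a multiple of the defect. *)
move=> p1; pose f (x : {poly R}) := x ^+ 2 *+ 3 - x ^+ 3 *+ 2.
have fB x : f x - x = (x ^+ 2 - x) * (1 - x *+ 2).
  by rewrite /f; ring.
have fI x : f x ^+ 2 - f x = (x ^+ 2 - x) * (x ^+ 2 - x) *
    ((x ^+ 2 - x) *+ 4 - 3%:R).
  by rewrite /f; ring.
pose P n := iter n f p.
have PI n : adic n.+1 (P n ^+ 2 - P n).
  elim: n => [//|n IHn]; rewrite /P iterS -/(P n) fI; apply: adicMr.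
  apply: adicSM => //; move: (P n ^+ 2 - P n) IHn => c.
  by elim: n => // n IHn /adicS.
have PS n : adic n.+1 (P n.+1 - P n) by rewrite /P iterS -/(P n) fB; exact: adicMr.
have [|q qE] := @adic_limit P; first by move=> n; exact: adicS.
have [n|s sE] := @adic_separated (q ^+ 2 - q); last first.
  exists q, s; split=> //; rewrite -(subrK (P 1%N) q) -addrA.
  by apply: adicD; [exact: qE | exact: (PS 0%N)].
have -> : q ^+ 2 - q = (q - P n) * (q + P n - 1) + (P n ^+ 2 - P n) by ring.
by apply: adicD; [exact: adicMr | exact: adicS].
Qed.

End ModMonic.

Lemma local_unit x : ~ m x -> exists y, x * y = 1.
Proof.
move=> mx; have [[m0 mD mM] m1 mmax] := m_max.
have unit1 c : m c -> exists y, (1 - c) * y = 1.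
  (* R is R[X]/(X): the inverse found there is read off by evaluation at 0. *)
  move=> mc; have [|q [s qs]] := @adic_unit 'X (monicX R) c%:P.
    by apply: adic1 => [|i]; [exact: monicX | rewrite coefC; case: eqP].
  exists q.[0]; have := congr1 (horner^~ 0) qs.
  by rewrite !hornerE ?mulr0 ?addr0.
pose I := [set z | exists c r, m c /\ z = c + r * x].
have [I1|I1] := pselect (I 1).
  have [c [r [mc e1]]] := I1; have [y yE] := unit1 c mc.
  by exists (r * y); rewrite mulrA [x * r]mulrC -[r * x](addKr c) -e1 addrC.
case: mx; rewrite -(mmax I) //; first by exists 0, 1; rewrite add0r mul1r.
  split; first by exists 0, 0; rewrite mul0r addr0.
  - move=> _ _ [c [r [mc ->]]] [c' [r' [mc' ->]]]; exists (c + c'), (r + r').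
    by split; [exact: mD | rewrite mulrDl addrACA].
  - move=> a _ [c [r [mc ->]]]; exists (a * c), (a * r).
    by split; [exact: mM | rewrite mulrDr mulrA].
by move=> c mc; exists c, 0; rewrite mul0r addr0.
Qed.

(* Modulo m, d = X^a q with q(0) a unit: p is the lift of the idempotent
   separating the two coprime factors. *)
Lemma fitting_idempotent (d : {poly R}) : d \is monic ->
  exists a p s r, [/\ p ^+ 2 - p = r * d, adic d 1 (p - 'X * s) &
    adic d 1 ('X^a * (1 - p))].
Proof.
move=> dm; have [_ m1 _] := m_max.
(* The least index of a coefficient outside [m]; it exists since the leading coefficient is 1. *)
have [|a /asboolP da amin] := @ex_minnP (fun i => `[< ~ m d`_i >]).
  by exists (size d).-1; apply/asboolP; rewrite -lead_coefE (monicP dm).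
have dlow i : (i < a)%N -> m d`_i.
  by move=> ia; apply: contrapT => /asboolP /amin; rewrite leqNgt ia.
have [y yE] := local_unit da.
(* [x] is q divided by q(0). Its constant term is 1, so [1 - x] is a multiple of X. *)
pose x := y *: drop_poly a d; pose s := drop_poly 1 (1 - x).
have sE : 1 - x = s * 'X.
  rewrite -[LHS](poly_take_drop 1) expr1 -/s; have -> : take_poly 1 (1 - x) = 0.
    apply/polyP => i; rewrite coef_take_poly coef0; case: i => //=.
    by rewrite coefB coefZ coef_drop_poly coef1 /= mulrC yE subrr.
  by rewrite add0r.
have xa : adic d 1 ('X^a * x).
  have -> : 'X^a * x = y%:P * d - y%:P * take_poly a d.
    by rewrite -{1}[d](poly_take_drop a) /x -mul_polyC; ring.
  apply: adicB => //; first exact: adic_multiple.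
  apply: adicMl => //; apply: adic1 => // i; rewrite coef_take_poly.
  by case: ltnP => [/dlow//|_]; have [] := m_ideal.
(* [w] is idempotent modulo m and [d]: it is a multiple of X^a, [1 - w] is a multiple of [x], and
   X^a x vanishes there. The exponent [a.+1] makes [w] a multiple of X even when [a = 0]. *)
pose w := (1 - x) ^+ a.+1; pose t := \sum_(i < a.+1) (1 - x) ^+ i.
have wt : 1 - w = x * t by rewrite /w -opprB subrX1 /t; ring.
have [|p [r [pw pr]]] := @adic_idempotent d dm w.
  have -> : w ^+ 2 - w = ('X^a * x) * (- (s ^+ a.+1 * 'X * t)).
    have -> : w ^+ 2 - w = - (w * (1 - w)) by ring.
    by rewrite wt /w sE exprMn ['X ^+ a.+1]exprS; ring.
  exact: adicMr.
exists a, p, (s * (1 - x) ^+ a), r; split=> //.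
  by have -> : 'X * (s * (1 - x) ^+ a) = w by rewrite /w exprS {2}sE; ring.
have -> : 'X^a * (1 - p) = ('X^a * x) * t - 'X^a * (p - w).
  by rewrite -mulrA -wt; ring.
by apply: adicB => //; [exact: adicMr | exact: adicMl].
Qed.

End CompleteLocal.

(** * Endomorphisms of indecomposable modules *)

Section LocalEndomorphisms.
Variable R : comNzRingType.

(* By Cayley-Hamilton, End(X) contains the image of R[X]/(d). *)
Lemma poly_action_ex (X : lmodType R) (e : {linear X -> X}) :
    finitely_generated X ->
  exists (d : {poly R}) (phi : {poly R} -> {linear X -> X}),
    [/\ d \is monic, forall x, phi d x = 0,
        forall p q x, phi (p - q) x = phi p x - phi q x,
        forall p q x, phi (p * q) x = phi p (phi q x) &
        (forall x, phi 1 x = x) /\ (forall x, phi 'X x = e x)].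
Proof.
move=> /fg_cover[n [v vs]]; have [l lE] := projective_rV (e \o v : {linear _ -> _}) vs.
pose A := lin1_mx l.
have vA c : v (c *m A) = e (v c) by rewrite mul_rV_lin1 lE.
(* The kernel of [v] is stable under [A], so polynomials in [A] act on the quotient [X]. *)
have stab p c : v c = 0 -> v (c *m horner_mx A p) = 0.
  move=> vc; elim/poly_ind: p => [|p a IHp]; first by rewrite rmorph0 mulmx0 linear0.
  rewrite rmorphD rmorphM /= horner_mx_X horner_mx_C mulmxDr linearD mul_mx_scalar.
  by rewrite [v (a *: c)]linearZ /= vc scaler0 addr0 -mulmxE mulmxA vA IHp linear0.
have act p : exists h : {linear X -> X}, forall c, h (v c) = v (c *m horner_mx A p).
  pose vp : {linear _ -> _} := v \o mulmxr (horner_mx A p).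
  exact: (@factor_surj R _ X X v vp vs (stab p)).
have [phi phiE] := choice act; exists (char_poly A), phi.
split; [exact: char_poly_monic|move=> x|move=> p q x|move=> p q x|split=> x];
  have [c <-] := vs x; rewrite !phiE.
- by rewrite Cayley_Hamilton mulmx0 linear0.
- by rewrite rmorphB mulmxBr linearB.
- by rewrite -mulmxA mulmxE -rmorphM mulrC.
- by rewrite rmorph1 -[c *m _]/(c *m 1%:M) mulmx1.
- by rewrite horner_mx_X vA.
Qed.

Hypothesis R_noetherian : noetherian_ring R.
Variable m : set R.
Hypothesis m_max : maximal_ideal m.
Hypothesis m_complete : adically_complete m.
Variable d : nat.
Hypothesis R_inj_dim : inj_dim_le d R^o.

(** The images of [e] and [1 - e] are Cohen-Macaulay, being retracts of [X], and split [X] inside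
    CM(R). *)
Lemma indecomposable_idempotent (X : CM R) (e : {linear X -> X}) :
    indecomposable hom_eq X -> (forall x, e (e x) = e x) ->
  (forall x, e x = 0) \/ (forall x, e x = x).
Proof.
move=> [_ Xind] ee.
pose e' : {linear X -> X} := (idfun \- e : {linear _ -> _}).
have summand (h : {linear X -> X}) : (forall x, h (h x) = h x) ->
    exists (A : CM R) (i : {linear A -> X}) (p : {linear X -> A}),
      (forall x, i (p x) = h x) /\ (forall y, p (i y) = y).
  move=> hh; have [A [i [ii iP]]] := kernel_ex (idfun \- h : {linear _ -> _}).
  have hP x : exists y, i y = h x by apply/iP; rewrite /= hh subrr.
  have [p pE] := factor_inj ii hP.
  have ip y : p (i y) = y.
    apply: ii; rewrite pE; apply/eqP; rewrite eq_sym -subr_eq0; apply/eqP.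
    by apply/(iP (i y)); exists y.
  have [Afg Aext] := is_CM_retract R_noetherian R_inj_dim ip (CM_is_CM X).
  by exists (MkCM Afg Aext), i, p.
have [A [i [p [ip pi]]]] := summand e ee.
have [|B [j [q [jq qj]]]] := summand e'.
  by move=> x; rewrite /e' /= linearB ee subrr subr0.
have pj y : p (j y) = 0.
  by rewrite -[y]qj jq /e' /= linearB /= -[e (j y)]ip pi subrr.
have qi y : q (i y) = 0.
  rewrite -[LHS]qj; have -> : j (q (i y)) = 0; last by rewrite linear0.
  by rewrite jq /e' /= -[e (i y)]ip pi subrr.
have [|A0|B0] := Xind A B.
- exists i, j, p, q; split=> x //=; rewrite /hom_eq /= ?ip ?jq //.
  by rewrite /e' /= addrC subrK.
- by left=> x; rewrite -ip [p x](A0 (p x)) linear0.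
- right=> x; apply/eqP; rewrite eq_sym -subr_eq0 -[x - e x]/(e' x).
  by rewrite -jq [q x](B0 (q x)) linear0.
Qed.

(** The lifted idempotent [p] acts as 0 or 1. If 0, X^a (1 - p) acts as [e^a], so [1 - e^a] is
    invertible, and it is a multiple of [1 - e]. If 1, the unit 1 - (p - X s) acts as [e] composed
    with the action of [s]. *)
Lemma indecomposable_local (X : CM R) (e : {linear X -> X}) :
    indecomposable hom_eq X ->
  (exists h : {linear X -> X}, forall x, e (h x) = x) \/
  (exists h : {linear X -> X}, forall x, h x - e (h x) = x).
Proof.
move=> Xind; have [c [phi [cm phic phiB phiM [phi1 phiX]]]] := poly_action_ex e (CM_fg X).
have [a [p [s [r [pp ps pX]]]]] := fitting_idempotent m_max m_complete cm.
have phic0 q x : phi (q * c) x = 0 by rewrite phiM phic linear0.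
have unit u : adic m c 1 u -> exists q, forall x, phi q x - phi u (phi q x) = x.
  move=> /(adic_unit m_max m_complete cm)[q [t qt]]; exists q => x.
  have := phic0 t x; have -> : t * c = (1 - u) * q - 1 by rewrite qt addrC addKr.
  by rewrite phiB phiM phiB !phi1 => /eqP; rewrite subr_eq0 => /eqP.
have ee x : phi p (phi p x) = phi p x.
  have := phic0 r x; rewrite -pp phiB expr2 phiM.
  by move/eqP; rewrite subr_eq0 => /eqP.
have [p0|p1] := indecomposable_idempotent Xind ee.
- right; have [q qE] := unit _ pX.
  exists (phi (\sum_(i < a) 'X^i) \o phi q : {linear _ -> _}) => x /=.
  rewrite -phiX -[X in X - _ = _]phi1 -phiB -phiM.
  rewrite -[RHS]qE; set z := phi q x.
  have -> : phi ('X^a * (1 - p)) z = phi 'X^a z.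
    by rewrite phiM phiB phi1 p0 subr0.
  have -> : (1 - 'X) * (\sum_(i < a) 'X^i) = 1 - 'X^a :> {poly R}.
    by rewrite -opprB mulNr -subrX1 opprB.
  by rewrite phiB phi1.
- left; have [q qE] := unit _ ps; exists (phi s \o phi q : {linear _ -> _}) => x /=.
  rewrite -[RHS]qE phiB p1 phiM phiX.
  by rewrite opprB addrC subrK.
Qed.

End LocalEndomorphisms.

(** * The stable category *)

Section StableCategory.
Variable R : comNzRingType.
Implicit Types L M N : lmodType R.

Lemma stable_eq_refl M N (f g : M -> N) : f =1 g -> stable_eq f g.
Proof.
move=> fg; exists 'rV[R]_0; split; first exact: free_rV.
exists (\0 : {linear _ -> _}), (\0 : {linear _ -> _}) => x.
by rewrite fg subrr.
Qed.

Lemma stable_eq_sym M N (f g : M -> N) : stable_eq f g -> stable_eq g f.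
Proof.
move=> [F [Ff [u [v uv]]]]; exists F; split=> //.
by exists u, (\- v : {linear _ -> _}) => x /=; rewrite -uv opprB.
Qed.

Lemma stable_eq_comp L M N (f g : M -> N) (k : {linear L -> M}) :
  stable_eq f g -> stable_eq (f \o k) (g \o k).
Proof.
move=> [F [Ff [u [v uv]]]]; exists F; split=> //.
by exists (u \o k : {linear _ -> _}), v => x /=; rewrite uv.
Qed.

(** Free modules being projective, any factorization lifts to a fixed cover of the target;
    factorizations can then be added, which gives transitivity. *)
Lemma stable_eq_cover M N n (v : {linear 'rV[R]_n -> N}) (f g : M -> N) :
    (forall y, exists x, v x = y) ->
  stable_eq f g <-> exists s : {linear M -> 'rV[R]_n}, forall x, f x - g x = v (s x).
Proof.
move=> vs; split=> [[F [Ff [u [w uw]]]]|[s sE]]; last first.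
  by exists 'rV[R]_n; split; [exact: free_rV | exists s, v].
have [h hE] := free_projective Ff w vs.
by exists (h \o u : {linear _ -> _}) => x; rewrite uw /= hE.
Qed.

Lemma stable_eq_trans M N (f g h : M -> N) : finitely_generated N ->
  stable_eq f g -> stable_eq g h -> stable_eq f h.
Proof.
move=> /fg_cover[n [v vs]] /(stable_eq_cover _ _ vs)[s sE].
move=> /(stable_eq_cover _ _ vs)[t tE]; apply/(stable_eq_cover _ _ vs).
exists (s \+ t : {linear _ -> _}) => x.
by rewrite /= linearD -sE -tE addrA subrK.
Qed.

End StableCategory.

(** * From Auslander-Reiten sequences to triangles *)

Section AuslanderReitenTriangles.
Variable R : comNzRingType.
Hypothesis R_noetherian : noetherian_ring R.
Variable d : nat.
Hypothesis R_inj_dim : inj_dim_le d R^o.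

(** Let [e = i p]. If [e h = 1], then stably 1 = q j = (q i) p h j = 0 on [B]. If [(1 - e) h = 1],
    then stably 1 = p i = p (1 - i p) h i = 0 on [A], since p i = 1. *)
Lemma indecomposable_stable (m : set R) (X : CM R) :
    maximal_ideal m -> adically_complete m ->
    indecomposable hom_eq X -> ~ zero_object stable_eq X ->
  indecomposable stable_eq X.
Proof.
move=> m_max m_complete Xind X0; split=> // A B [i [j [p [q [pi qj qi pj ipjq]]]]].
have [] := indecomposable_local R_noetherian m_max m_complete R_inj_dim
  (i \o p : {linear _ -> _}) Xind => [[h hE]|[h hE]].
- right; apply: (stable_eq_trans (CM_fg B) (stable_eq_sym qj)).
  have := stable_eq_comp (p \o (h \o j) : {linear _ -> _}) qi.
  apply: (stable_eq_trans (CM_fg B)); apply: stable_eq_refl => y /=.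
  by rewrite -[i _]/((i \o p) (h (j y))) hE.
- left; apply: (stable_eq_trans (CM_fg A) (stable_eq_sym pi)).
  have [F [Ff [u [v uv]]]] :=
    stable_eq_comp (p \o (h \o i) : {linear _ -> _}) (stable_eq_sym pi).
  exists F; split=> //; exists u, v => y; rewrite -uv subr0 /=.
  by rewrite -linearB -[i (p _)]/((i \o p) (h (i y))) hE.
Qed.

Section ShortExact.
Variables (Z Y X : CM R) (a : {linear Z -> Y}) (f : {linear Y -> X}).
Hypothesis af : short_exact a f.

(** Ext^1(X, R) = 0, applied to each coordinate. *)
Lemma extend_rV n (g : {linear Z -> 'rV[R]_n}) :
  exists h : {linear Y -> 'rV[R]_n}, forall z, h (a z) = g z.
Proof.
have [ai ex fs] := af.
have Xext := CM_extendable R_noetherian R_inj_dim (CM_is_CM X).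
have coord i : exists h : {linear Y -> R^o}, forall z, h (a z) = g z 0 i.
  have [|gi giE] := @linear_ex R Z R^o (fun z => g z 0 i).
    by move=> c x y; rewrite linearP !mxE.
  have [|h hE] := Xext _ _ a f gi ex fs; last by exists h => z; rewrite hE giE.
  by move=> x ax0; rewrite (ai x 0) ?linear0 // ax0 linear0.
have [h hE] := choice coord.
have [|H HE] := @linear_ex R Y 'rV[R]_n (fun y => \row_i h i y).
  by move=> c x y; apply/rowP => i; rewrite !mxE linearP.
by exists H => z; apply/rowP => i; rewrite HE mxE hE.
Qed.

Lemma extend_projective (P : lmodType R) (g : {linear Z -> P}) :
    finitely_generated P -> projective_module P ->
  exists h : {linear Y -> P}, forall z, h (a z) = g z.
Proof.
move=> /fg_cover[n [v vs]] Pp; have [s sE] := Pp _ _ v idfun vs.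
have [h hE] := extend_rV (s \o g : {linear _ -> _}).
by exists (v \o h : {linear _ -> _}) => z; rewrite /= hE /= sE.
Qed.

Lemma retraction_split (r : {linear Y -> Z}) :
  (forall z, r (a z) = z) -> split_epi hom_eq f.
Proof.
move=> ra; have [ai ex fs] := af.
have [|s sE] := @factor_surj R Y X Y f (idfun \- (a \o r) : {linear _ -> _}) fs.
  by move=> y /ex[z <-]; rewrite /= ra subrr.
exists s => x; have [y <-] := fs x; rewrite /= sE /= linearB /=.
by have -> : f (a (r y)) = 0; [apply/ex; exists (r y) | rewrite subr0].
Qed.

Lemma stable_zero_end_split : zero_object stable_eq X -> split_epi hom_eq f.
Proof.
have [n [v vs]] := fg_cover (CM_fg X); have [ai ex fs] := af.
move=> /(stable_eq_cover _ _ vs)[s sE]; have [l lE] := projective_rV v fs.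
by exists (l \o s : {linear _ -> _}) => x; rewrite /= lE -sE subr0.
Qed.

(** The identity of [Z] factors through a finite free module; extending its first factor to [Y]
    gives a retraction of [a]. *)
Lemma stable_zero_start_split : zero_object stable_eq Z -> split_epi hom_eq f.
Proof.
have [n [v vs]] := fg_cover (CM_fg Z).
move=> /(stable_eq_cover _ _ vs)[s sE]; have [h hE] := extend_rV s.
apply: (@retraction_split (v \o h : {linear _ -> _})) => z.
by rewrite /= hE -sE subr0.
Qed.

Variable T : shift R.

Lemma connecting_ex : exists w : {linear X -> cos_obj (T Z)}, connecting a f w.
Proof.
have [ai ex fs] := af; have [ci cex cs] := cos_exact (T Z).
have [e eE] := extend_projective (cos_in (T Z)) (CM_fg _)
  (free_projective (cos_freeP (T Z))).
have [|w wE] := @factor_surj R Y X _ f (cos_out (T Z) \o e : {linear _ -> _}) fs.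
  by move=> y /ex[z <-]; rewrite /= eE; apply/cex; exists z.
by exists w, e; split=> // y; rewrite wE.
Qed.

(* If w factors through a free module, it lifts along F -> Z[1]; correcting
   Y -> F by this lift yields a retraction of a. *)
Lemma connecting_zero_split (w : {linear X -> cos_obj (T Z)}) :
  connecting a f w -> stable_eq w (fun=> 0) -> split_epi hom_eq f.
Proof.
move=> [e [ea we]] [F [Ff [u [v uv]]]]; have [ai ex fs] := af.
have [ci cex cs] := cos_exact (T Z).
have [l lE] := free_projective Ff v cs.
pose s : {linear X -> cos_free (T Z)} := (l \o u : {linear _ -> _}).
have sE x : cos_out (T Z) (s x) = w x by rewrite lE -uv subr0.
have [|r rE] := factor_inj (g := (e \- (s \o f) : {linear _ -> _})) ci.
  move=> y; apply/cex; by rewrite linearB -we sE subrr.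
apply: (@retraction_split r) => z; apply: ci; rewrite rE /= ea.
by have -> : f (a z) = 0; [apply/ex; exists z | rewrite !linear0 addr0].
Qed.

Lemma induced_triangle_triangle (w : {linear X -> cos_obj (T Z)}) :
  induced_triangle a f w -> triangle a f w.
Proof.
move=> afw; exists Z, Y, X, a, f, w; split=> //.
have iso_id (M : CM R) : iso stable_eq (idfun : {linear M -> M}).
  by exists idfun; split; exact: stable_eq_refl.
exists idfun, idfun, idfun, idfun.
by split; [split | exists idfun | exact: stable_eq_refl..].
Qed.

End ShortExact.

Lemma shift_ex : inhabited (shift R).
Proof.
have cos (Z : CM R) : inhabited (cosyzygy Z).
  have [n [C [u [v [uv [Cfg Cext]]]]]] := cosyzygy_ex R_noetherian R_inj_dim (CM_is_CM Z).
  have [Ffg Fext] := is_CM_rV R_inj_dim n.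
  pose F := MkCM Ffg Fext; pose C' := MkCM Cfg Cext.
  by constructor; exact: (@Cosyzygy R Z F C' u v (@free_rV R n) uv).
by constructor => Z; exact: inhabited_witness (cos Z).
Qed.

Lemma AR_sequence_triangle (m : set R) (Z Y X : CM R) (a : {linear Z -> Y})
    (f : {linear Y -> X}) (T : shift R) (w : {linear X -> cos_obj (T Z)}) :
    maximal_ideal m -> adically_complete m ->
  AR_sequence a f -> induced_triangle a f w -> AR_triangle a f w.
Proof.
move=> m_max m_complete [af [Xind Zind] fsplit AR3] afw; split.
- exact: induced_triangle_triangle.
- split; apply: (indecomposable_stable m_max m_complete) => //.
    by move=> /(stable_zero_end_split af).
  by move=> /(stable_zero_start_split af).
- by move=> /(connecting_zero_split af afw.2).
(* A splitting in CM(R) is also a stable one, so [g] is not a split epimorphism in CM(R) and the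
   lift of (AR3) serves. *)
- move=> W g gsplit; have [|h hE] := AR3 W g; last by exists h; exact: stable_eq_refl.
  by move=> [s sE]; apply: gsplit; exists s; exact: stable_eq_refl.
Qed.

End AuslanderReitenTriangles.

(** Existence of a shift and of [w] keeps the claim from being vacuous. Two choices of [w] differ by
    a map through the free middle term of the cosyzygy, so the claim is made for each of them. *)
Theorem proposition2p2 (k : closedFieldType) (hk : [pchar k] =i pred0)
    (R : comAlgType k) (m : set R)
    (R_noetherian : noetherian_ring R) (R_local : local_ring m)
    (R_complete : adically_complete m) (R_gorenstein : gorenstein R)
    (Z Y X : CM R) (a : {linear Z -> Y}) (f : {linear Y -> X})
    (haf : AR_sequence a f) :
  inhabited (shift R) /\
  forall T : shift R,
    (exists w : {linear X -> cos_obj (T Z)}, induced_triangle a f w) /\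
    (forall w : {linear X -> cos_obj (T Z)}, induced_triangle a f w ->
       AR_triangle a f w).
Proof.
have [d R_inj_dim] := finite_inj_dim_le R_gorenstein.
split=> [|T]; first exact (shift_ex R_noetherian R_inj_dim).
have [af _ _ _] := haf; split=> [|w afw].
  by have [w wc] := connecting_ex R_noetherian R_inj_dim af T; exists w.
exact: (AR_sequence_triangle R_noetherian R_inj_dim R_local.1 R_complete haf afw).
Qed.
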